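(* Let $m=n+2$. Then every instance with $n$ agents with monotone valuations and $m$ goods has at least $n$ EFX allocations. *)

(* Defs.v *)
From HB Require Import structures.
From mathcomp Require Import all_boot all_order all_algebra.
Set Implicit Arguments. Unset Strict Implicit. Unset Printing Implicit Defensive.
Import Order.TTheory GRing.Theory Num.Theory.
Local Open Scope ring_scope.

Definition valuations (R : realFieldType) (n m : nat) := 'I_n -> {set 'I_m} -> R.

Definition monotone_vals (R : realFieldType) (n m : nat) (v : valuations R n m) :=
  forall (i : 'I_n) (S T : {set 'I_m}), S \subset T -> v i S <= v i T.

(* A (complete) allocation of the m goods to the n agents: every good is given to
   exactly one agent, encoded as the map good |-> owner. *)
Definition allocation (n m : nat) := {ffun 'I_m -> 'I_n}.

Definition bundle (n m : nat) (a : allocation n m) (i : 'I_n) : {set 'I_m} :=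
  [set g | a g == i].

Definition EFX (R : realFieldType) (n m : nat) (v : valuations R n m)
  (a : allocation n m) : bool :=
  [forall i : 'I_n, forall j : 'I_n, forall g : 'I_m, (g \in bundle a j) ==>
    (v i (bundle a j :\ g) <= v i (bundle a i))].

(* Main.v *)
Require Import Defs.
From HB Require Import structures.
From mathcomp Require Import all_boot all_order all_algebra.
Import Order.TTheory GRing.Theory Num.Theory.
Local Open Scope ring_scope.

(** Call an agent an owner if it gets at least two goods; there are at most two
    owners in the allocations below.  Fix an agent j and let the others pick their
    best remaining good one after the other; three goods C are left.

    If nobody envies a pair of goods of C, giving C to j is EFX with sole owner j.
    Otherwise some k prefers a pair P of C to its own good.  Rerunning the picks
    without k frees one good z = y_s that no agent but possibly j prefers to its
    original pick y.  If j values z at least as much as the second best pair of C,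
    then j can take z and the good of C outside P while k takes P, so that j owns
    its favourite among the four shared goods.  Otherwise j can take either of the
    two best pairs of C, and s takes z with the remaining good: two allocations
    with owners {j, s}.

    The theorem follows by counting allocations over owner sets.  An owner set {j, k}
    is charged at most by j and by k; if both charge it, there are two allocations
    with these owners, because when both j and k hold their favourite shared good in
    the same allocation they can exchange their other goods. *)

(** * Serial picking, and its repair after adding a good or removing an agent *)

(* If the pick y l of the first agent l is worse for it than g, l switches to g and
   the rest of the list reacts to the freed good y l; z is what remains at the end. *)
Lemma insert_good (R : realFieldType) (n m : nat) (u : 'I_n -> 'I_m -> R)
    (y : 'I_n -> 'I_m) (L : seq 'I_n) (g : 'I_m) :
  uniq L -> pairwise (fun l l' => u l (y l') <= u l (y l)) L ->
  exists (y' : 'I_n -> 'I_m) (z : 'I_m),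
    [/\ perm_eq (z :: map y' L) (g :: map y L),
        forall l, l \in L -> u l (y l) <= u l (y' l)
      & forall l, l \in L -> u l z <= u l (y l)].
Proof.
elim: L g => [|l L IH] g /=; first by move=> _ _; exists y, g.
case/andP=> lL uL /andP[/allP ly yL].
have ext x (y1 : 'I_n -> 'I_m) :
  map (fun i => if i == l then x else y1 i) L = map y1 L.
  apply/eq_in_map => i iL; case: eqP => // il.
  by rewrite -il iL in lL.
have le_z h z (y1 : 'I_n -> 'I_m) : perm_eq (z :: map y1 L) (h :: map y L) ->
    u l h <= u l (y l) -> u l z <= u l (y l).
  move=> p hh; have : z \in h :: map y L by rewrite -(perm_mem p) mem_head.
  by rewrite inE => /predU1P[->|/mapP[i iL ->]] //; apply: ly.
have [gl|/ltW gl] := leP (u l g) (u l (y l)).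
- have [y' [z [p up zy]]] := IH g uL yL.
  exists (fun i => if i == l then y l else y' i), z; split.
  + rewrite eqxx ext (perm_catCA [:: z] [:: y l]) /= perm_sym.
    by rewrite (perm_catCA [:: g] [:: y l]) /= perm_cons perm_sym.
  + move=> i; rewrite inE; case: eqP => [-> //|_] /=; exact: up.
  + move=> i; rewrite inE => /predU1P[->|]; last exact: zy.
    exact: le_z p gl.
- have [y' [z [p up zy]]] := IH (y l) uL yL.
  exists (fun i => if i == l then g else y' i), z; split.
  + by rewrite eqxx ext (perm_catCA [:: z] [:: g]) /= perm_cons.
  + move=> i; rewrite inE; case: eqP => [-> //|_] /=; exact: up.
  + move=> i; rewrite inE => /predU1P[->|]; last exact: zy.
    exact: le_z p (lexx _).
Qed.

(** Agents before [k] keep their picks, and the freed good [y k] is inserted into the list after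
    [k]. The final [z] is [y k] or the pick of an agent after [k], so the pairwise condition bounds
    it for every agent up to [k]. *)
Lemma remove_picker (R : realFieldType) (n m : nat) (u : 'I_n -> 'I_m -> R)
    (y : 'I_n -> 'I_m) (L : seq 'I_n) (k : 'I_n) :
  uniq L -> pairwise (fun l l' => u l (y l') <= u l (y l)) L -> k \in L ->
  exists (y' : 'I_n -> 'I_m) (z : 'I_m),
    [/\ perm_eq (z :: map y' (rem k L)) (map y L),
        forall l, l \in rem k L -> u l (y l) <= u l (y' l)
      & forall l, l \in L -> u l z <= u l (y l)].
Proof.
elim: L => //= h L IH /andP[hL uL] /andP[/allP hy yL]; rewrite inE.
have ext x (y1 : 'I_n -> 'I_m) :
  map (fun i => if i == h then x else y1 i) (rem k L) = map y1 (rem k L).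
  apply/eq_in_map => i /mem_rem iL; case: eqP => // ih.
  by rewrite -ih iL in hL.
have le_z w z (s : seq 'I_m) : perm_eq (z :: s) w ->
    {subset w <= y h :: map y L} -> u h z <= u h (y h).
  move=> p sub; have : z \in y h :: map y L.
    by apply: sub; rewrite -(perm_mem p) mem_head.
  by rewrite inE => /predU1P[->|/mapP[i iL ->]] //; apply: hy.
case: (eqVneq h k) => [hk _|hk] /=.
- have [y' [z [p up zy]]] := insert_good R n m u y L (y h) uL yL.
  exists y', z; split=> // i; rewrite inE => /predU1P[->|]; last exact: zy.
  exact: le_z p _.
- move=> kL; have [y' [z [p up zy]]] := IH uL yL kL.
  exists (fun i => if i == h then y h else y' i), z; split.
  + by rewrite /= eqxx ext (perm_catCA [:: z] [:: y h]) /= perm_cons.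
  + by move=> i; rewrite inE; case: eqP => [-> //|_] /=; apply: up.
  + move=> i; rewrite inE => /predU1P[->|]; last exact: zy.
    by apply: le_z p _ => c cL; rewrite inE cL orbT.
Qed.

(** Each agent in turn takes a favourite among the goods left by its predecessors. Outside [L], [y]
    has the default value [g0]. *)
Lemma serial_picks (R : realFieldType) (n m : nat) (u : 'I_n -> 'I_m -> R)
    (g0 : 'I_m) (L : seq 'I_n) (G : seq 'I_m) :
  uniq L -> (size L <= size G)%N ->
  exists (y : 'I_n -> 'I_m) (C : seq 'I_m),
    [/\ perm_eq (map y L ++ C) G,
        pairwise (fun l l' => u l (y l') <= u l (y l)) L
      & forall l c, l \in L -> c \in C -> u l c <= u l (y l)].
Proof.
elim: L G => [|l L IH] G /=; first by exists (fun=> g0), G.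
case/andP=> lL uL sG.
have [g1 g1G] : exists g1, g1 \in G.
  by case: G sG => // g1 G _; exists g1; rewrite mem_head.
have [g gG gmax] := @arg_maxP _ R _ g1 (mem G) (u l) g1G.
have [|y [C [p yL yC]]] := IH (rem g G) uL.
  by rewrite size_rem // -ltnS prednK //; case: (G) gG.
have subG : {subset map y L ++ C <= G}.
  by move=> c; rewrite (perm_mem p) => /mem_rem.
have ext i : i \in L -> (if i == l then g else y i) = y i.
  by move=> iL; case: eqP => // il; rewrite -il iL in lL.
exists (fun i => if i == l then g else y i), C; rewrite eqxx; split.
- rewrite perm_sym (perm_trans (perm_to_rem gG)) // perm_cons perm_sym.
  by have /eq_in_map-> : {in L, (fun i => if i == l then g else y i) =1 y}.
- apply/andP; split.
    apply/allP => i iL; rewrite ext //; apply: gmax; apply: subG.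
    by rewrite mem_cat map_f.
  apply: etrans yL; apply: (@eq_in_pairwise _ (mem L)); last exact/allP.
  by move=> i i' iL i'L; rewrite !ext.
- move=> i c; rewrite inE => /predU1P[->|iL] cC.
    by rewrite eqxx; apply: gmax; apply: subG; rewrite mem_cat cC orbT.
  by rewrite ext //; apply: yC.
Qed.

(** * Allocations built from single picks and leftover goods *)

Lemma uniq_map_inj_in (T1 T2 : eqType) (f : T1 -> T2) (s : seq T1) :
  uniq (map f s) -> {in s &, injective f}.
Proof.
elim: s => //= x s IH /andP[fx us] a b; rewrite !inE.
case/predU1P=> [->|aS] /predU1P[->|bS] // fab.
- by rewrite fab map_f in fx.
- by rewrite -fab map_f in fx.
- exact: IH.
Qed.

(** The permutation lists each good exactly once, so [y] is injective on [L] and avoids [D]: a good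
    goes to the agent of [L] that picked it, and otherwise to its image under [f]. *)
Lemma allocation_of_singles (n m : nat) (y : 'I_n -> 'I_m) (L : seq 'I_n)
    (D : seq 'I_m) (f : 'I_m -> 'I_n) :
  perm_eq (map y L ++ D) (enum 'I_m) -> (forall g, g \in D -> f g \notin L) ->
  exists a : allocation n m,
    (forall l, l \in L -> bundle a l = [set y l]) /\
    (forall i, i \notin L -> bundle a i = [set g in D | f g == i]).
Proof.
move=> p fD.
have : uniq (map y L ++ D) by rewrite (perm_uniq p) enum_uniq.
rewrite cat_uniq => /and3P[/uniq_map_inj_in yinj /hasPn disj _].
have cov g : g \in map y L ++ D by rewrite (perm_mem p) mem_enum.
exists [ffun g => if [pick l | (l \in L) && (y l == g)] is Some l then l else f g].
split=> [l lL|i iL]; apply/setP => g; rewrite !inE ffunE.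
- case: pickP => [l' /andP[l'L /eqP <-]|noL].
    by apply/eqP/eqP => [->|/yinj->].
  have gy : g != y l by move: (noL l); rewrite lL eq_sym /= => ->.
  rewrite (negbTE gy); apply: contraNF (fD g _) => [/eqP-> //|].
  move: (cov g); rewrite mem_cat => /orP[/mapP[l' l'L gl']|//].
  by move: (noL l'); rewrite l'L -gl' eqxx.
- case: pickP => [l' /andP[l'L /eqP <-]|noL].
    have /negbTE-> : y l' \notin D.
      by apply: contraL (map_f y l'L) => yD; exact: disj.
    by apply: contraNF iL => /eqP <-.
  suff -> : g \in D by [].
  move: (cov g); rewrite mem_cat => /orP[/mapP[l' l'L gl']|//].
  by move: (noL l'); rewrite l'L -gl' eqxx.
Qed.

(** * Owners, and EFX when two owners hold a pair each *)

Definition owners (n m : nat) (a : allocation n m) : {set 'I_n} :=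
  [set i | (1 < #|bundle a i|)%N].

Arguments owners {n m} a.

(** A bundle of at most one good becomes empty when a good is removed, and by monotonicity the empty
    set is not envied. *)
Lemma EFX_owners (R : realFieldType) (n m : nat) (v : valuations R n m)
    (a : allocation n m) :
  monotone_vals v ->
  (forall i j g, j \in owners a -> i != j -> g \in bundle a j ->
     v i (bundle a j :\ g) <= v i (bundle a i)) ->
  EFX v a.
Proof.
move=> mono H; apply/forallP => i; apply/forallP => j; apply/forallP => g.
apply/implyP => gj; have [->|ij] := eqVneq i j; first exact/mono/subsetDl.
have [jo|] := boolP (j \in owners a); first exact: H.
rewrite inE -leqNgt => le1; apply: mono; suff -> : bundle a j :\ g = set0 by exact: sub0set.
apply/eqP; rewrite -cards_eq0 -leqn0 -ltnS; move: le1.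
by rewrite (cardsD1 g) gj.
Qed.

Lemma setD1_pair (T : finType) (x y : T) : x != y -> [set x; y] :\ x = [set y].
Proof.
move=> xy; apply/setP => z; rewrite !inE.
by case: eqVneq => //= ->; rewrite (negbTE xy).
Qed.

Lemma pair_setD1 (T : finType) (x y g : T) :
  x != y -> g \in [set x; y] ->
  exists2 h, h \in [set x; y] & [set x; y] :\ g = [set h].
Proof.
move=> xy; rewrite !inE => /orP[]/eqP->; [exists y | exists x];
  rewrite ?inE ?eqxx ?orbT //; first exact: setD1_pair.
by rewrite setUC setD1_pair // eq_sym.
Qed.

(** A pair less one good is a single good, so EFX only compares bundles with single goods among [p],
    [q], [r], [s]. *)
Lemma EFX_two_pairs (R : realFieldType) (n m : nat) (v : valuations R n m)
    (y : 'I_n -> 'I_m) (L : seq 'I_n) (j k : 'I_n) (p q r s : 'I_m) :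
  monotone_vals v -> j != k -> j \notin L -> k \notin L ->
  (forall i, [|| i == j, i == k | i \in L]) ->
  perm_eq (map y L ++ [:: p; q; r; s]) (enum 'I_m) ->
  (forall l g, l \in L -> g \in [:: p; q; r; s] -> v l [set g] <= v l [set y l]) ->
  (forall g, g \in [set r; s] -> v j [set g] <= v j [set p; q]) ->
  (forall g, g \in [set p; q] -> v k [set g] <= v k [set r; s]) ->
  exists a : allocation n m,
    [/\ EFX v a, owners a = [set j; k],
        bundle a j = [set p; q] & bundle a k = [set r; s]].
Proof.
move=> mono jk jL kL cov pe vL vj vk.
have : uniq (map y L ++ [:: p; q; r; s]) by rewrite (perm_uniq pe) enum_uniq.
rewrite cat_uniq /= !inE !negb_or => /and3P[_ _].
case/and4P=> /and3P[pq pr ps] /andP[qr qs] rs _.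
have kj : (k == j) = false by rewrite eq_sym (negbTE jk).
pose f g := if (g == p) || (g == q) then j else k.
have [|a [aL aD]] := @allocation_of_singles n m y L _ f pe.
  by move=> g _; rewrite /f; case: ifP.
have aj : bundle a j = [set p; q].
  rewrite aD //; apply/setP => g; rewrite !inE /f.
  by case: (g == p); case: (g == q); rewrite ?eqxx ?kj ?andbT ?andbF.
have ak : bundle a k = [set r; s].
  rewrite aD //; apply/setP => g; rewrite !inE /f.
  case: (eqVneq g p) => [->|_] /=; first by rewrite (negbTE jk) (negbTE pr) (negbTE ps).
  case: (eqVneq g q) => [->|_] /=; first by rewrite (negbTE jk) (negbTE qr) (negbTE qs).
  by rewrite eqxx andbT.
have oa : owners a = [set j; k].
  apply/setP => i; rewrite !inE; case/or3P: (cov i) => [/eqP->|/eqP->|iL].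
  - by rewrite aj cards2 pq eqxx.
  - by rewrite ak cards2 rs eqxx orbT.
  - rewrite aL // cards1; apply/esym/negbTE; rewrite negb_or.
    by apply/andP; split; apply: contraTneq iL => ->.
exists a; split=> //; apply: EFX_owners => // i h g.
rewrite oa in_set2 => /orP[]/eqP->.
- rewrite aj => ij gp; have [h' h'p ->] := @pair_setD1 _ _ _ _ pq gp.
  case/or3P: (cov i) => [/eqP ij'|/eqP->|iL]; first by rewrite ij' eqxx in ij.
    by rewrite ak; apply: vk.
  rewrite aL //; apply: vL => //; move: h'p; rewrite !inE.
  by case/orP=> ->; rewrite ?orbT.
- rewrite ak => ij gp; have [h' h'p ->] := @pair_setD1 _ _ _ _ rs gp.
  case/or3P: (cov i) => [/eqP->|/eqP ij'|iL]; last 1 first.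
  + rewrite aL //; apply: vL => //; move: h'p; rewrite !inE.
    by case/orP=> ->; rewrite ?orbT.
  + by rewrite aj; apply: vj.
  + by rewrite ij' eqxx in ij.
Qed.

(** * Exchanging second goods, and one allocation for each agent *)

Definition owns_top (R : realFieldType) (n m : nat) (v : valuations R n m)
    (j : 'I_n) (a : allocation n m) : Prop :=
  exists y u, [/\ y != u, bundle a j = [set y; u]
    & forall i g, i \in owners a -> g \in bundle a i -> v j [set g] <= v j [set y]].

Arguments owns_top {R n m} v j a.

(** After [u] and [t] are exchanged, [j] still has [y] and [k] still has [w], each a favourite among
    the four goods, so neither envies a single good of the other. *)
Lemma swap_seconds (R : realFieldType) (n m : nat) (v : valuations R n m)
    (a : allocation n m) (j k : 'I_n) :
  monotone_vals v -> EFX v a -> j != k -> owners a = [set j; k] ->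
  owns_top v j a -> owns_top v k a ->
  exists a' : allocation n m, [/\ EFX v a', owners a' = [set j; k] & a' != a].
Proof.
move=> mono /forallP efx jk oa [y [u [yu aj topj]]] [w [t [wt ak topk]]].
have kj : (k == j) = false by rewrite eq_sym (negbTE jk).
have own_j g : (a g == j) = (g \in [set y; u]) by rewrite -aj inE.
have own_k g : (a g == k) = (g \in [set w; t]) by rewrite -ak inE.
have au : a u = j by apply/eqP; rewrite own_j !inE eqxx orbT.
have at_ : a t = k by apply/eqP; rewrite own_k !inE eqxx orbT.
have ay : a y = j by apply/eqP; rewrite own_j !inE eqxx.
have aw : a w = k by apply/eqP; rewrite own_k !inE eqxx.
have neq g h : a g = j -> a h = k -> (g == h) = false.
  by move=> gj hk; apply/eqP => gh; move: jk; rewrite -gj -hk gh eqxx.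
pose b : allocation n m := [ffun g => if g == u then k else if g == t then j else a g].
have bj : bundle b j = [set y; t].
  apply/setP => g; rewrite !inE ffunE.
  case: (eqVneq g u) => [->|gu]; first by rewrite kj (neq u t) // eq_sym (negbTE yu).
  case: (eqVneq g t) => [->|gt]; first by rewrite eqxx orbT.
  by rewrite own_j !inE (negbTE gu) !orbF.
have bk : bundle b k = [set w; u].
  apply/setP => g; rewrite !inE ffunE.
  case: (eqVneq g u) => [->|gu]; first by rewrite eqxx orbT.
  case: (eqVneq g t) => [->|gt]; first by rewrite (negbTE jk) eq_sym (negbTE wt).
  by rewrite own_k !inE (negbTE gt) !orbF.
have bi i : i != j -> i != k -> bundle b i = bundle a i.
  move=> ij ik; apply/setP => g; rewrite !inE ffunE.
  case: (eqVneq g u) => [->|gu]; first by rewrite au eq_sym (negbTE ik) eq_sym (negbTE ij).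
  case: (eqVneq g t) => [->|gt] //.
  by rewrite at_ eq_sym (negbTE ij) eq_sym (negbTE ik).
(* Each of the four goods is what remains of a pair of [a] without its other good, so EFX of [a]
   gives the bound. *)
have single i g : i != j -> i != k -> g \in [:: y; u; w; t] ->
    v i [set g] <= v i (bundle a i).
  move=> ij ik; move: (efx i) => /forallP ei; rewrite !inE.
  have /forallP ej := ei j; have /forallP ek := ei k.
  case/or4P=> /eqP->.
  - by move: (ej u); rewrite aj !inE eqxx orbT setUC setD1_pair // eq_sym.
  - by move: (ej y); rewrite aj !inE eqxx setD1_pair.
  - by move: (ek t); rewrite ak !inE eqxx orbT setUC setD1_pair // eq_sym.
  - by move: (ek w); rewrite ak !inE eqxx setD1_pair.
have ob : owners b = [set j; k].
  apply/setP => i; rewrite -oa !inE.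
  have [->|ij] := eqVneq i j; first by rewrite bj aj !cards2 yu (neq y t).
  have [->|ik] := eqVneq i k; first by rewrite bk ak !cards2 wt eq_sym (neq u w).
  by rewrite bi.
exists b; split=> //; last first.
  by apply/eqP => /ffunP/(_ u); rewrite ffunE eqxx au => /eqP; rewrite kj.
have topj' g : g \in [set w; u] -> v j [set g] <= v j [set y; t].
  move=> gw; apply: le_trans (mono j _ _ (subsetUl _ _)).
  move: gw; rewrite !inE => /orP[]/eqP->.
    by apply: (topj k); rewrite ?oa ?ak !inE eqxx ?orbT.
  by apply: (topj j); rewrite ?oa ?aj !inE eqxx ?orbT.
have topk' g : g \in [set y; t] -> v k [set g] <= v k [set w; u].
  move=> gw; apply: le_trans (mono k _ _ (subsetUl _ _)).
  move: gw; rewrite !inE => /orP[]/eqP->.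
    by apply: (topk j); rewrite ?oa ?aj !inE eqxx ?orbT.
  by apply: (topk k); rewrite ?oa ?ak !inE eqxx ?orbT.
apply: EFX_owners => // i h g; rewrite ob in_set2 => /orP[]/eqP->.
- rewrite bj => ij gy.
  have [|h' h'y ->] := @pair_setD1 _ _ _ _ _ gy; first by rewrite (neq y t).
  have [->|ik] := eqVneq i k; first by rewrite bk; apply: topk'.
  rewrite bi //; apply: single => //; move: h'y; rewrite !inE.
  by case/orP=> ->; rewrite ?orbT.
- rewrite bk => ik gy.
  have [|h' h'y ->] := @pair_setD1 _ _ _ _ _ gy.
    by rewrite eq_sym (neq u w).
  have [->|ij] := eqVneq i j; first by rewrite bj; apply: topj'.
  rewrite bi //; apply: single => //; move: h'y; rewrite !inE.
  by case/orP=> ->; rewrite ?orbT.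
Qed.

(** The outcomes fit the counting: a singleton owner set is charged by one agent only, a second
    allocation covers a second charge, and [owns_top] permits an exchange if both owners choose the
    same allocation. *)
Lemma EFX_for_agent (R : realFieldType) (n : nat) (v : valuations R n (n + 2)%N)
    (j : 'I_n) :
  monotone_vals v ->
  exists a : allocation n (n + 2)%N, EFX v a /\
    (owners a = [set j] \/
     exists k, [/\ j != k, owners a = [set j; k]
       & owns_top v j a \/ exists a' : allocation n (n + 2)%N,
           [/\ EFX v a', owners a' = [set j; k] & a' != a]]).
Proof.
move=> mono.
pose L := rem j (enum 'I_n).
have uL : uniq L by rewrite rem_uniq ?enum_uniq.
have memL i : (i \in L) = (i != j) by rewrite mem_rem_uniq ?enum_uniq // inE mem_enum andbT.
have jL : j \notin L by rewrite memL eqxx.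
have n0 : (0 < n)%N by case: (j) => i; apply: leq_ltn_trans.
have sL : size L = n.-1 by rewrite size_rem ?mem_enum // size_enum_ord.
have [|y [C [pC yL yC]]] := @serial_picks R n _ (fun l g => v l [set g])
    (widen_ord (leq_addr 2 n) j) L (enum 'I_(n + 2)) uL.
  by rewrite sL size_enum_ord (leq_trans (leq_pred n)) ?leq_addr.
(* The [n - 1] picks out of [n + 2] goods leave three. *)
have sC : size C = 3%N.
  have := perm_size pC; rewrite size_cat size_map sL size_enum_ord => h.
  by apply: (@addnI n.-1); rewrite h -{1}(prednK n0) addSnnS.
have uC : uniq C.
  have : uniq (map y L ++ C) by rewrite (perm_uniq pC) enum_uniq.
  by rewrite cat_uniq => /and3P[].
have cov k i : [|| i == j, i == k | i \in rem k L].
  by rewrite mem_rem_uniq // inE memL; case: (i == j); case: (i == k).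
have pair (x1 x2 x3 : 'I_(n + 2)) : perm_eq [:: x1; x2; x3] C ->
    [set g in C] :\ x1 = [set x2; x3].
  move=> p; have : uniq [:: x1; x2; x3] by rewrite (perm_uniq p).
  rewrite /= !inE !negb_or => /and3P[/andP[x12 x13] _ _].
  apply/setP => g; rewrite !inE -(perm_mem p) !inE.
  by case: (eqVneq g x1) => [->|] //=; rewrite (negbTE x12) (negbTE x13).
have [envyfree|] := boolP [forall l in L, forall g in C,
    v l ([set x in C] :\ g) <= v l [set y l]].
  have [|a [aL aD]] := @allocation_of_singles n _ y L C (fun=> j) pC.
    by move=> g _.
  have aj : bundle a j = [set x in C].
    by rewrite aD //; apply/setP => g; rewrite !inE eqxx andbT.
  have oa : owners a = [set j].
    apply/setP => i; rewrite !inE; have [->|ij] := eqVneq i j.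
      by rewrite aj cardsE (card_uniqP uC) sC.
    by rewrite aL ?memL // cards1.
  exists a; split; last by left.
  apply: EFX_owners => // i h g; rewrite oa in_set1 => /eqP-> ij.
  rewrite aj inE aL ?memL // => gC.
  by move/forall_inP: envyfree => /(_ i); rewrite memL ij => /(_ isT)/forall_inP/(_ g gC).
case/forall_inPn => k kL /forall_inPn[g gC]; rewrite -ltNge => envy.
have jk : j != k by rewrite eq_sym -memL.
have [y' [z [pz y'y zy]]] :=
  @remove_picker R n _ (fun l g => v l [set g]) y L k uL yL kL.
(* Sorting goods by the value for [j] of the complementary pair makes [[set x2; x3]] its best pair,
   [[set x1; x3]] the second and [[set x1; x2]] the worst. *)
have srtC := sort_sorted
  (fun x1 x2 => le_total (v j ([set x in C] :\ x2)) (v j ([set x in C] :\ x1))) C.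
move: srtC (perm_sort (fun x1 x2 => v j ([set x in C] :\ x2) <= v j ([set x in C] :\ x1)) C).
set S := sort _ _; move=> srt pS.
have : size S = 3%N by rewrite (perm_size (_ : perm_eq S C)) ?pS.
case: S srt pS => [|x1 [|x2 [|x3 []]]] //= srt pS _.
have p1 : perm_eq [:: x1; x2; x3] C by rewrite pS.
have p2 : perm_eq [:: x2; x1; x3] C.
  by apply: perm_trans p1; rewrite (perm_catCA [:: x2] [:: x1]).
have p3 : perm_eq [:: x3; x1; x2] C.
  by apply: perm_trans p1; rewrite (perm_catC [:: x3] [:: x1; x2]).
move: srt; rewrite (pair _ _ _ p1) (pair _ _ _ p2) (pair _ _ _ p3) andbT => /andP[T21 T32].
have in1 (x x' : 'I_(n + 2)) : v j [set x] <= v j [set x; x'] by apply/mono/subsetUl.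
have in2 (x x' : 'I_(n + 2)) : v j [set x'] <= v j [set x; x'] by apply/mono/subsetUr.
(* [x1] and [x3] lie in the second best pair, and [x2] lies in the worst one. *)
have le2 c : c \in C -> v j [set c] <= v j [set x1; x3].
  rewrite -(perm_mem p1) !inE => /or3P[]/eqP-> //.
  exact: le_trans (in2 x1 x2) T32.
(* In the first case [j] takes [z] and [g], [k] takes the envied pair [p], [q], and the others hold
   their new picks [y']. *)
have [T2z|/ltW zT2] := leP (v j [set x1; x3]) (v j [set z]).
- have [p [q pq]] : exists p q, perm_eq [:: g; p; q] C.
    have := perm_to_rem gC; have := size_rem gC; rewrite sC.
    case: (rem g C) => [|p [|q []]] //= _ pr; exists p, q.
    by rewrite perm_sym.
  rewrite (pair _ _ _ pq) in envy.
  have mem4 c : c \in [:: z; g; p; q] -> c = z \/ c \in C.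
    by rewrite -(perm_mem pq) inE => /predU1P[]; [left|right].
  have topz c : c \in [:: z; g; p; q] -> v j [set c] <= v j [set z].
    by case/mem4 => [->|/le2] // h; apply: le_trans T2z.
  have [|||||||a [efx oa aj ak]] := @EFX_two_pairs R n _ v y' (rem k L) j k z g p q mono jk.
  + by apply: contra jL => /mem_rem.
  + by rewrite mem_rem_uniq // inE eqxx.
  + exact: cov.
  + apply: perm_trans pC; rewrite (perm_catCA _ [:: z]).
    exact: perm_cat pz pq.
  + move=> l c lL; have lL' := mem_rem lL; case/mem4 => [->|cC].
      exact: le_trans (zy l lL') (y'y l lL).
    exact: le_trans (yC l c lL' cC) (y'y l lL).
  + move=> c cp; apply: le_trans (in1 z g); apply: topz.
    by move: cp; rewrite !inE => /orP[]->; rewrite ?orbT.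
  (* For [k], neither [z] nor [g] beats its old pick [y k], which is worth less than the envied
     pair. *)
  + move=> c; rewrite !inE => /orP[]/eqP->; apply: le_trans (ltW envy).
      exact: zy.
    exact: yC.
  exists a; split=> //; right; exists k; split=> //; left.
  exists z, g; split=> //.
    apply: contraTneq gC => <-.
    have : uniq (map y L ++ C) by rewrite (perm_uniq pC) enum_uniq.
    rewrite cat_uniq => /and3P[_ /hasPn disj _].
    have zL : z \in map y L by rewrite -(perm_mem pz) mem_head.
    by apply: contraL zL => zC; apply: disj.
  move=> i c; rewrite oa in_set2 => /orP[]/eqP->.
    by rewrite aj => h; apply: topz; move: h; rewrite !inE => /orP[]->; rewrite ?orbT.
  by rewrite ak => h; apply: topz; move: h; rewrite !inE => /orP[]->; rewrite ?orbT.
(* In the second case the original picks [y] are kept; [s] may be [k]. *)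
- have [s s_in zs] : exists2 s, s \in L & z = y s.
    by apply/mapP; rewrite -(perm_mem pz) mem_head.
  have js : j != s by rewrite eq_sym -memL.
  (* [s] keeps [z = y s], at least as good for it as any good of [C]; only [j] has to compare its
     pair with [z] and [a]. *)
  have build (a b c : 'I_(n + 2)) : perm_eq [:: a; b; c] C ->
      v j [set z] <= v j [set b; c] -> v j [set a] <= v j [set b; c] ->
      exists w : allocation n (n + 2)%N,
        [/\ EFX v w, owners w = [set j; s] & bundle w j = [set b; c]].
    move=> pa hz ha.
    have [|||||||w [efx ow wj _]] := @EFX_two_pairs R n _ v y (rem s L) j s b c z a mono js.
    + by apply: contra jL => /mem_rem.
    + by rewrite mem_rem_uniq // inE eqxx.
    + exact: cov.
    + apply: perm_trans pC.
      have pL := perm_map y (perm_to_rem s_in); rewrite /= -zs perm_sym in pL.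
      apply: perm_trans (perm_cat pL pa).
      rewrite perm_sym /= (perm_catCA [:: z]) perm_cat2l.
      by rewrite (perm_catC [:: z; a] [:: b; c]).
    + move=> l d /mem_rem lL dC.
      have [->|dC'] : d = z \/ d \in C; [|exact: zy|exact: yC].
      rewrite -(perm_mem pa); move: dC; rewrite !inE.
      by case/or4P=> /eqP->; rewrite ?eqxx ?orbT; auto.
    + by move=> d; rewrite !inE => /orP[]/eqP->.
    + move=> d dbc; apply: le_trans (mono s [set z] _ (subsetUl _ _)).
      rewrite zs; apply: yC => //; rewrite -(perm_mem pa) !inE.
      by move: dbc; rewrite !inE => /orP[]->; rewrite ?orbT.
    by exists w.
  have [|w2 [efx2 ow2 w2j]] := build _ _ _ p2 zT2.
    by apply: le2; rewrite -(perm_mem p2) mem_head.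
  have [||w1 [efx1 ow1 w1j]] := build _ _ _ p1.
  + exact: le_trans zT2 T21.
  + exact: le_trans (in1 x1 x3) T21.
  exists w1; split=> //; right; exists s; split=> //; right; exists w2; split=> //.
  apply: contraTneq (eqxx (bundle w1 j)) => ww; rewrite -{2}ww w1j w2j.
  have : uniq [:: x1; x2; x3] by rewrite (perm_uniq p1).
  rewrite /= !inE !negb_or => /and3P[/andP[x12 x13] _ _].
  apply/eqP => /setP/(_ x1); rewrite !inE eqxx.
  by rewrite (negbTE x12) (negbTE x13).
Qed.

(** * Counting allocations by owner sets *)

Theorem theorem6 (R : realFieldType) (n : nat) (v : valuations R n (n + 2)%N) :
  monotone_vals v ->
  (n <= #|[set a : allocation n (n + 2)%N | EFX v a]|)%N.
Proof.
move=> mono.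
have [w Hw] := fin_all_exists (fun j => EFX_for_agent R n v j mono).
have ow j : j \in owners (w j).
  by have [_ [->|[k [_ -> _]]]] := Hw j; rewrite !inE eqxx.
rewrite -{1}(card_ord n) -sum1_card -sum1_card.
(* Agents are grouped by the owners of their chosen allocation, EFX allocations by their owners; the
   two groups are compared for each owner set [e]. *)
rewrite (partition_big (fun j => owners (w j)) predT) //=.
rewrite [leqRHS](partition_big (@owners n _) predT) //=.
apply: leq_sum => e _; rewrite !sum1_card.
set Se := (X in (_ <= X)%N).
have two (a a' : allocation n (n + 2)) : EFX v a -> owners a = e -> EFX v a' ->
    owners a' = e -> a' != a -> (1 < Se)%N.
  move=> ea oa ea' oa' aa'; apply/card_gt1P; exists a', a.
  by split; rewrite // unfold_in inE ?ea ?ea' ?oa ?oa' eqxx.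
have [j ej|none] := pickP [pred j | owners (w j) == e]; last by rewrite eq_card0.
have {}ej : owners (w j) = e by apply/eqP.
have [efx cases] := Hw j.
have one : (0 < Se)%N.
  by apply/card_gt0P; exists (w j); rewrite unfold_in inE efx ej eqxx.
(* Every agent is an owner in its chosen allocation, so only members of [e] charge [e]. *)
have sub_e : [pred i | owners (w i) == e] \subset e.
  by apply/subsetP => i /eqP <-; apply: ow.
case: cases => [oj|[k [jk oj cases]]].
  by apply: leq_trans (subset_leq_card sub_e) _; rewrite -ej oj cards1.
have fibre2 : (1 < Se)%N -> (#|[pred i | owners (w i) == e]| <= Se)%N.
  by apply: leq_trans; apply: leq_trans (subset_leq_card sub_e) _; rewrite -ej oj cards2 jk.
case: cases => [topj|[a' [efx' oa' aw]]]; last first.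
  by apply: fibre2; apply: (two (w j) a') => //; rewrite oa' -oj.
(* If [k] charges another set, [j] alone charges [e] and one allocation suffices. *)
have [ek|nek] := eqVneq (owners (w k)) e; last first.
  apply: leq_trans one; apply: (leq_trans (n := #|[set j]|)); last by rewrite cards1.
  apply/subset_leq_card/subsetP => i ie.
  move/subsetP: sub_e => /(_ i ie); rewrite -ej oj !inE => /orP[//|/eqP ik].
  by have : owners (w i) == e := ie; rewrite ik (negbTE nek).
(* Both charge [e]: distinct choices are the two allocations, while a common choice calls for the
   exchange or for the second allocation provided by [k]. *)
apply: fibre2; have [wjk|] := eqVneq (w k) (w j); last first.
  by apply: two => //; have [] := Hw k.
have [_ [ok|[k' [kk' ok cases]]]] := Hw k.
  by move: (ow j) jk; rewrite ej -ek ok inE => ->.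
have {}kk' : k' = j.
  move: (ow j); rewrite ej -ek ok !inE (negbTE jk) => /eqP //.
case: cases => [topk|[a' [efx' oa' aw]]]; last first.
  by apply: (two (w k) a') => //; rewrite ?oa' -?ok // wjk.
rewrite wjk in topk.
have [a' [efx' oa' aw]] := @swap_seconds R n _ v (w j) j k mono efx jk oj topj topk.
by apply: (two (w j) a') => //; rewrite oa' -oj.
Qed.
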